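(* For every integer $a\ge 2$, we have $$\Gamma(a,a+1)\ne\Gamma(a^2,(a+1)^2).$$
   Context: For coprime positive integers $a,b$, it is known that exactly one of the two equations $ax+by=\frac{(a-1)(b-1)}{2}$ and $1+ax+by=\frac{(a-1)(b-1)}{2}$ has a solution in nonnegative integers $x,y$. Define $\Gamma(a,b)=0$ if the first equation has such a solution, and $\Gamma(a,b)=1$ if the second does. *)

(* Defs.v *)
From mathcomp Require Import zify.
From mathcomp Require Import all_boot.

Set Implicit Arguments.
Unset Strict Implicit.
Unset Printing Implicit Defensive.

(* Truncated halving is exact for coprime a and b: see half_targetK. *)
Definition half_target (a b : nat) : nat := ((a - 1) * (b - 1)) %/ 2.

(* For positive a and b, any solution of either equation satisfies
   x, y <= half_target a b, so the bounded search is exhaustive; Gamma0P and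
   Gamma1P characterize the values by unbounded solvability. *)
Definition Gamma (a b : nat) : nat :=
  if [exists x : 'I_(half_target a b).+1, exists y : 'I_(half_target a b).+1,
        a * x + b * y == half_target a b]
  then 0 else 1.

Lemma half_targetK (a b : nat) :
  coprime a b -> 2 * half_target a b = (a - 1) * (b - 1).
Proof.
move=> cab; have : odd a || odd b.
  apply: contraLR cab; rewrite negb_or -!dvdn2 => /andP[da db].
  apply/negP => /eqP g1; have := dvdn_gcd 2 a b.
  by rewrite da db g1.
rewrite /half_target => h; rewrite mulnC divnK // dvdn2 oddM negb_and.
by case/orP: h => h; apply/orP; [left | right]; lia.
Qed.

Lemma Gamma0P (a b : nat) : 0 < a -> 0 < b ->
  Gamma a b = 0 <-> exists x y : nat, a * x + b * y = half_target a b.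
Proof.
move=> a0 b0; rewrite /Gamma; split.
  case: ifP => // /existsP[x /existsP[y /eqP h]] _; by exists x, y.
case=> x [y h]; case: ifP => // /existsP[].
have hx : x < (half_target a b).+1.
  by rewrite ltnS -h (leq_trans (leq_pmull x a0)) ?leq_addr.
have hy : y < (half_target a b).+1.
  by rewrite ltnS -h (leq_trans (leq_pmull y b0)) ?leq_addl.
by exists (Ordinal hx); apply/existsP; exists (Ordinal hy); apply/eqP.
Qed.

Lemma solvable_exclusive (a b x y x' y' : nat) : 0 < a -> 0 < b ->
  coprime a b ->
  a * x + b * y = half_target a b -> 1 + a * x' + b * y' = half_target a b ->
  False.
Proof.
move=> a0 b0 cab h h'; have e := half_targetK cab.
have E : a * (x + x' + 1) + b * (y + y' + 1) = a * b.
  case: a b a0 b0 e h h' {cab} => [|a] [|b] // _ _.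
  by rewrite !subn1 /=; lia.
have : b %| a * (x + x' + 1).
  rewrite -(dvdn_addl (a * (x + x' + 1)) (dvdn_mulr (y + y' + 1) (dvdnn b))).
  by rewrite E dvdn_mull.
rewrite Gauss_dvdr; last by rewrite coprime_sym.
move/dvdn_leq => /(_ ltac:(lia)); rewrite -(leq_pmul2l a0) -E.
by rewrite mulnDr; lia.
Qed.

Lemma solvable_total (a b : nat) : 0 < a -> 0 < b -> coprime a b ->
  (exists x y : nat, a * x + b * y = half_target a b) \/
  (exists x y : nat, 1 + a * x + b * y = half_target a b).
Proof.
move=> a0 b0 cab; move: (half_target a b) (half_targetK cab) => N e.
case: (egcdnP b a0) => k m hk _.
rewrite (eqP cab) in hk.
have [x [hx hm]] : exists x, x < b /\ a * x = N %[mod b].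
  exists ((k * N) %% b); split; first by rewrite ltn_mod.
  by rewrite modnMmr mulnA (mulnC a) hk mulnDl mul1n mulnAC modnMDl.
case: (leqP (a * x) N) => hN.
  left; exists x, ((N - a * x) %/ b).
  have : b %| N - a * x by rewrite -eqn_mod_dvd // hm.
  by move/divnK; rewrite mulnC => ->; lia.
right; have : b %| a * x - N by rewrite -eqn_mod_dvd ?hm // ltnW.
case/dvdnP => q hq; exists (b - 1 - x), (q - 1).
have q0 : 0 < q by case: q hq => // hq; lia.
have [r er] : exists r, b = x + r + 1 by exists (b - 1 - x); lia.
have -> : b - 1 - x = r by lia.
case: q q0 hq => // q _ hq; rewrite subn1 /=.
have {hN} hq : a * x = N + q.+1 * b by lia.
case: a a0 {cab hk hm} e hq => // a _; rewrite {hx}er addn1 !subn1 /=.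
by move=> e hq; lia.
Qed.

Lemma Gamma1P (a b : nat) : 0 < a -> 0 < b -> coprime a b ->
  Gamma a b = 1 <-> exists x y : nat, 1 + a * x + b * y = half_target a b.
Proof.
move=> a0 b0 cab; split=> [g1|[x [y h]]].
  have [/(Gamma0P a0 b0)|//] := solvable_total a0 b0 cab.
  by rewrite g1.
have : Gamma a b <> 0.
  by move=> /(Gamma0P a0 b0) [x' [y' h']]; apply: (solvable_exclusive a0 b0 cab h' h).
by rewrite /Gamma; case: ifP.
Qed.

(* Main.v *)
Require Import Defs.
From mathcomp Require Import all_boot zify.

(** Both values of [Gamma] depend only on the parity of [a], in opposite ways,
    and each is certified by an explicit nonnegative solution.
    - If [a] is even, then [1 + (a + 1) * (a/2 - 1) = (a - 1) * a / 2], so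
      [Gamma a (a + 1) = 1], while
      [a^2 * (a + 1) + (a + 1)^2 * (a * (a - 2) / 2)] equals
      [(a^2 - 1) * ((a + 1)^2 - 1) / 2], so the value at the squares is [0].
    - If [a] is odd, then [a * ((a - 1) / 2) = (a - 1) * a / 2], so
      [Gamma a (a + 1) = 0], while
      [1 + a^2 * ((a^2 - 3) / 2) + (a + 1)^2 * (a - 1)] equals
      [(a^2 - 1) * ((a + 1)^2 - 1) / 2], so the value at the squares is [1].

    The parametrizations [a = 2 * m + 2] and [a = 2 * m + 3] make these
    polynomial identities in [m], free of truncated subtraction and division. *)

Lemma half_target_eq (a b n : nat) :
  (a - 1) * (b - 1) = 2 * n -> half_target a b = n.
Proof. by rewrite /half_target => ->; rewrite mulKn. Qed.

Lemma coprime_succ (a : nat) : coprime a (a + 1).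
Proof. by rewrite addn1 coprimenS. Qed.

Lemma Gamma_succ_even (m : nat) : Gamma (2 * m + 2) (2 * m + 2 + 1) = 1.
Proof.
apply/Gamma1P; [lia | lia | exact: coprime_succ |].
by exists 0, m; symmetry; apply: half_target_eq; rewrite addnK; nia.
Qed.

Lemma Gamma_succ_odd (m : nat) : Gamma (2 * m + 3) (2 * m + 3 + 1) = 0.
Proof.
apply/Gamma0P; [lia | lia |].
by exists m.+1, 0; symmetry; apply: half_target_eq; rewrite addnK; nia.
Qed.

Lemma Gamma_sqr_even (m : nat) :
  Gamma ((2 * m + 2) ^ 2) ((2 * m + 2 + 1) ^ 2) = 0.
Proof.
apply/Gamma0P; [by rewrite expn_gt0; lia | by rewrite expn_gt0; lia |].
exists (2 * m + 3), (2 * m * (m + 1)); symmetry; apply: half_target_eq.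
have -> : (2 * m + 2) ^ 2 - 1 = (2 * m + 1) * (2 * m + 3) by nia.
have -> : (2 * m + 2 + 1) ^ 2 - 1 = (2 * m + 2) * (2 * m + 4) by nia.
by nia.
Qed.

Lemma Gamma_sqr_odd (m : nat) :
  Gamma ((2 * m + 3) ^ 2) ((2 * m + 3 + 1) ^ 2) = 1.
Proof.
apply/Gamma1P; [by rewrite expn_gt0; lia | by rewrite expn_gt0; lia | |].
  by rewrite coprimeXl // coprimeXr // coprime_succ.
exists (2 * m ^ 2 + 6 * m + 3), (2 * m + 2); symmetry; apply: half_target_eq.
have -> : (2 * m + 3) ^ 2 - 1 = (2 * m + 2) * (2 * m + 4) by nia.
have -> : (2 * m + 3 + 1) ^ 2 - 1 = (2 * m + 3) * (2 * m + 5) by nia.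
by nia.
Qed.

Theorem theorem4p8 (a : nat) (ha : 2 <= a) :
  Gamma a (a + 1) <> Gamma (a ^ 2) ((a + 1) ^ 2).
Proof.
have [m [-> | ->]] : exists m, a = 2 * m + 2 \/ a = 2 * m + 3.
  by exists ((a - 2) %/ 2); lia.
- by rewrite Gamma_succ_even Gamma_sqr_even.
- by rewrite Gamma_succ_odd Gamma_sqr_odd.
Qed.
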